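(* Let $m\geq 1$ be an integer, let $\alpha_0^{(1)},\ldots,\alpha_0^{(m)}$ be irrational real numbers for which the Jacobi--Perron algorithm does not terminate, let $(a_n^{(i)})_{n=0}^\infty$, $i=1,\ldots,m$, be the sequences of partial quotients it produces, and let $\left(A_n^{(i)}/A_n^{(m+1)}\right)_{n=0}^\infty$, $i=1,\ldots,m$, be the associated sequences of convergents. If the sequences $(A_n^{(i)})_{n=0}^\infty$, $i=1,\ldots,m+1$, are all linear recurrence sequences, then the sequences $(a_n^{(i)})_{n=0}^\infty$, $i=1,\ldots,m$, are all periodic.
   Context: Jacobi--Perron algorithm: given real numbers $\alpha_0^{(1)},\ldots,\alpha_0^{(m)}$, define for $n=0,1,2,\ldots$ $$a_n^{(i)}=[\alpha_n^{(i)}]\ (i=1,\ldots,m),\qquad \alpha_{n+1}^{(1)}=\frac{1}{\alpha_n^{(m)}-a_n^{(m)}},\qquad \alpha_{n+1}^{(i)}=\frac{\alpha_n^{(i-1)}-a_n^{(i-1)}}{\alpha_n^{(m)}-a_n^{(m)}}\ (i=2,\ldots,m),$$ where $[\cdot]$ is the integer part (floor). The integers $a_n^{(i)}$ are the partial quotients of the multidimensional continued fraction $[\{a_0^{(1)},a_1^{(1)},\ldots\},\ldots,\{a_0^{(m)},a_1^{(m)},\ldots\}]$ of $(\alpha_0^{(1)},\ldots,\alpha_0^{(m)})$. The algorithm does not terminate when $\alpha_n^{(m)}\neq a_n^{(m)}$ for all $n\geq 0$, so that all the sequences are infinite. Numerators and denominators of convergents: the convergents are $\left(A_n^{(1)}/A_n^{(m+1)},\ldots,A_n^{(m)}/A_n^{(m+1)}\right)$,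 $n\ge 0$, where the integers $A_n^{(i)}$ are defined by $$A_n^{(i)}=\sum_{j=1}^m a_n^{(j)}A_{n-j}^{(i)}+A_{n-m-1}^{(i)},\quad i=1,\ldots,m+1,\ n\geq 1,$$ with initial conditions $A_0^{(i)}=a_0^{(i)}$, $A_{-i}^{(i)}=1$, $A_{-j}^{(i)}=0$ for $i,j\in\{1,\ldots,m\}$, $j\neq i$, and $A_0^{(m+1)}=1$, $A_{-i}^{(m+1)}=0$ for $i=1,\ldots,m$. A sequence $(s_n)_{n=0}^\infty$ is called periodic if it is periodic from some index on (a pre-period is allowed): there are $N\geq 0$ and $q\geq 1$ with $s_{n+q}=s_n$ for all $n\geq N$. The pre-periods and periods of the $m$ sequences of partial quotients may differ. A linear recurrence sequence is a sequence $(s_n)_{n=0}^\infty$ satisfying a linear homogeneous recurrence with constant coefficients: there are $d\geq 1$ and constants $c_1,\ldots,c_d\in\mathbb C$ (possibly zero) with $s_n=c_1s_{n-1}+\cdots+c_ds_{n-d}$ for all $n\geq d$. *)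

(* Defs.v *)
From mathcomp Require Import all_boot all_order all_algebra.
From mathcomp Require Import all_classical all_reals.
From mathcomp Require Import complex.

Set Implicit Arguments.
Unset Strict Implicit.
Unset Printing Implicit Defensive.

Import Order.TTheory GRing.Theory Num.Theory.
Local Open Scope ring_scope.

(* A family x^(1), ..., x^(m) is a function on nat of which only the values at
   the indices 1, ..., m are used. *)

(* [jp_complete m alpha n i] is alpha_n^(i). *)
Fixpoint jp_complete (R : realType) (m : nat) (alpha : nat -> R) (n : nat)
    : nat -> R :=
  if n is k.+1 then
    let x := jp_complete m alpha k in
    let frac i := x i - (Num.floor (x i))%:~R in
    fun i => if i == 1%N then 1 / frac m else frac i.-1 / frac m
  else alpha.

(* [jp_quotient m alpha n i] is a_n^(i). *)
Definition jp_quotient (R : realType) (m : nat) (alpha : nat -> R) (n i : nat)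
    : int :=
  Num.floor (jp_complete m alpha n i).

Definition jp_nonterminating (R : realType) (m : nat) (alpha : nat -> R)
    : Prop :=
  forall n : nat, jp_complete m alpha n m <> (jp_quotient m alpha n m)%:~R.

(* [A i n] is A_n^(i), for 1 <= i <= m + 1 and n >= - m.  The conditions below
   determine it on this range, by recursion on n; its other values are
   irrelevant. *)
Record jp_convergents (m : nat) (a : nat -> nat -> int) (A : nat -> int -> int)
    : Prop := JPConvergents {
  jp_num0 : forall i : nat, (1 <= i <= m)%N -> A i 0 = a 0%N i ;
  jp_num_diag : forall i : nat, (1 <= i <= m)%N -> A i (- i%:Z) = 1 ;
  jp_num_offdiag : forall i j : nat,
    (1 <= i <= m)%N -> (1 <= j <= m)%N -> j != i -> A i (- j%:Z) = 0 ;
  jp_den0 : A m.+1 0 = 1 ;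
  jp_den_neg : forall j : nat, (1 <= j <= m)%N -> A m.+1 (- j%:Z) = 0 ;
  jp_rec : forall i n : nat, (1 <= i <= m.+1)%N -> (1 <= n)%N ->
    A i n%:Z = \sum_(1 <= j < m.+1) a n j * A i (n%:Z - j%:Z)
               + A i (n%:Z - m%:Z - 1) }.

Definition eventually_periodic (T : Type) (s : nat -> T) : Prop :=
  exists N q : nat, (1 <= q)%N /\ forall n : nat, (N <= n)%N -> s (n + q)%N = s n.

(* The coefficients c j, 1 <= j <= d, may vanish, including c d. *)
Definition linear_recurrence (F : fieldType) (s : nat -> F) : Prop :=
  exists (d : nat) (c : nat -> F), (1 <= d)%N /\
    forall n : nat, (d <= n)%N -> s n = \sum_(1 <= j < d.+1) c j * s (n - j)%N.

(* Main.v *)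
Require Import Defs.
From mathcomp Require Import all_boot all_order all_algebra.
From mathcomp Require Import all_classical all_reals.
From mathcomp Require Import complex.
From mathcomp Require Import zify.

Import Order.TTheory GRing.Theory Num.Theory.
Local Open Scope ring_scope.

(** Why the theorem is true.

    Let V_n be the square matrix of size m+1 whose columns are the convergent
    vectors A_n, A_{n-1}, ..., A_{n-m}.  The recursion of the algorithm says
    V_{n+1} = V_n X_n, where X_n is the companion-like matrix carrying the
    partial quotients a_{n+1}^(i); all these matrices lie in GL_{m+1}(Z).

    If every coordinate of A_n satisfies a linear recurrence, then one monic
    polynomial p annihilates all of them, so sum_k p_k V_{n+k} = 0.
    Multiplying by the inverse of V_n turns this into a relation between the
    products X_n X_{n+1} ... X_{n+k-1} alone.  The relation expresses the longest
    product through the shorter ones, so X_{n+D} is a function of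
    X_n, ..., X_{n+D-1}, the same function for every n
    ([transition_determined]): the partial quotients form a finite-memory
    dynamical system.

    Such a system is eventually periodic as soon as one window of D consecutive
    states occurs twice ([recurrent_window_periodic]), and by the pigeonhole
    principle it is enough to have infinitely many windows with entries below a
    fixed bound.  These come from growth.  The partial quotients
    satisfy 0 <= a_n^(i) <= a_n^(1) and 1 <= a_n^(1), so that the denominator
    A_n^(m+1) is at least a_1^(1) ... a_n^(1) ([prod_le_jp_denominator]).  A
    linear recurrence sequence grows at most geometrically
    ([linear_recurrence_growth]), so the geometric mean of the a_n^(1) is
    bounded, and large values are too rare to meet every window of length D
    ([bounded_windows]). *)

Set Implicit Arguments.
Unset Strict Implicit.

(** * Annihilating polynomials of linear recurrences *)

Definition shift_apply (F : fieldType) (p : {poly F}) (s : nat -> F) (n : nat) : F :=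
  \sum_(k < size p) p`_k * s (n + k)%N.

Lemma shift_apply_widen (F : fieldType) (p : {poly F}) (s : nat -> F) (n K : nat) :
  (size p <= K)%N -> shift_apply p s n = \sum_(k < K) p`_k * s (n + k)%N.
Proof.
move=> pK; rewrite /shift_apply (big_ord_widen _ (fun k => p`_k * s (n + k)%N) pK).
rewrite big_mkcond /=; apply: eq_bigr => k _; case: ltnP => // kp.
by rewrite nth_default // mul0r.
Qed.

Lemma shift_applyD (F : fieldType) (p q : {poly F}) (s : nat -> F) (n : nat) :
  shift_apply (p + q) s n = shift_apply p s n + shift_apply q s n.
Proof.
pose K := maxn (size p) (size q).
rewrite !(@shift_apply_widen _ _ _ _ K) ?leq_maxl ?leq_maxr ?size_polyD //.
by rewrite -big_split /=; apply: eq_bigr => k _; rewrite coefD mulrDl.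
Qed.

Lemma shift_applyZ (F : fieldType) (c : F) (p : {poly F}) (s : nat -> F) (n : nat) :
  shift_apply (c *: p) s n = c * shift_apply p s n.
Proof.
rewrite (@shift_apply_widen _ _ _ _ (size p)) ?size_scale_leq // mulr_sumr.
by apply: eq_bigr => k _; rewrite coefZ mulrA.
Qed.

Lemma shift_applyMX (F : fieldType) (p : {poly F}) (s : nat -> F) (n : nat) :
  shift_apply (p * 'X) s n = shift_apply p s n.+1.
Proof.
rewrite (@shift_apply_widen _ _ _ _ (size p).+1); last first.
  by apply: leq_trans (size_polyMleq _ _) _; rewrite size_polyX addn2.
rewrite big_ord_recl coefMX mul0r add0r; apply: eq_bigr => k _.
by rewrite coefMX /= addnS.
Qed.

Definition annihilates (F : fieldType) (p : {poly F}) (s : nat -> F) : Prop :=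
  forall n, shift_apply p s n = 0.

(** Annihilating polynomials form an ideal; this is what allows recurrences of
    different sequences to be merged into one. *)
Lemma annihilatesM (F : fieldType) (q p : {poly F}) (s : nat -> F) :
  annihilates p s -> annihilates (q * p) s.
Proof.
move=> ps; elim/poly_ind: q => [|q c IH] n.
  by rewrite mul0r /shift_apply size_poly0 big_ord0.
rewrite mulrDl mul_polyC shift_applyD shift_applyZ ps mulr0 addr0.
by rewrite -mulrA ['X * p]mulrC mulrA shift_applyMX IH.
Qed.

Lemma linear_recurrence_annihilator (F : fieldType) (s : nat -> F) :
  linear_recurrence s -> exists2 p : {poly F}, p \is monic & annihilates p s.
Proof.
move=> [d [c [d_gt0 sE]]].
pose r : {poly F} := \poly_(k < d) c (d - k)%N.
have rd : (size (- r) <= d)%N by rewrite size_polyN size_poly.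
exists ('X^d - r).
  by rewrite monicE lead_coefDl ?lead_coefXn // size_polyXn ltnS.
move=> n; rewrite (@shift_apply_widen _ _ _ _ d.+1); last first.
  by rewrite size_polyDl size_polyXn ?ltnS.
rewrite big_ord_recr /= coefB coefXn eqxx coef_poly ltnn subr0 mul1r.
rewrite (sE (n + d)%N) ?leq_addl // big_add1 big_mkord (reindex_inj rev_ord_inj) /=.
rewrite -big_split /= big1 // => k _.
rewrite coefB coefXn coef_poly.
have kd := ltn_ord k.
have -> : (d - k.+1 == d)%N = false by lia.
have -> : (d - k.+1 < d)%N by lia.
have -> : (d - (d - k.+1) = k.+1)%N by lia.
have -> : (n + (d - k.+1) = n + d - k.+1)%N by lia.
by rewrite sub0r mulNr addNr.
Qed.

Lemma common_annihilator (F : fieldType) (N : nat) (s : nat -> nat -> F) :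
  (forall i, (i < N)%N -> linear_recurrence (s i)) ->
  exists2 p : {poly F}, p \is monic & forall i, (i < N)%N -> annihilates p (s i).
Proof.
elim: N => [|N IH] sL; first by exists 1; rewrite ?monic1.
have [i iN|p p_monic ps] := IH; first by apply: sL; lia.
have [q q_monic qs] := linear_recurrence_annihilator (sL N (ltnSn N)).
exists (p * q); first by rewrite monicMl.
move=> i; rewrite ltnS leq_eqVlt => /orP[/eqP->|iN]; first exact: annihilatesM.
by rewrite mulrC; apply: annihilatesM; apply: ps.
Qed.

(** * Geometric growth and windows of small values *)

(** By induction, a bound K >= 1 that dominates the sum of the absolute values of
    the coefficients and the initial values gives |s_n| <= K^(n+1). *)
Lemma linear_recurrence_growth (R : realType) (s : nat -> int) :
  linear_recurrence (fun n => (s n)%:~R : complex R) ->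
  exists C : nat, forall n, s n <= (C ^ n.+1)%N%:Z.
Proof.
move=> [d [c [d_gt0 sE]]].
pose t n : complex R := (s n)%:~R.
pose K : complex R := 1 + \sum_(1 <= j < d.+1) `|c j| + \sum_(n < d) `|t n|.
have c_ge0 : 0 <= \sum_(1 <= j < d.+1) `|c j| by apply: sumr_ge0.
have t_ge0 : 0 <= \sum_(n < d) `|t n| by apply: sumr_ge0.
have K_ge1 : 1 <= K by rewrite /K -addrA lerDl addr_ge0.
have tK n : `|t n| <= K ^+ n.+1.
  elim/ltn_ind: n => n IH; case: (ltnP n d) => [nd|dn].
    apply: le_trans (_ : K <= _); last by rewrite exprS ler_peMr ?exprn_ege1 // (le_trans ler01).
    rewrite /K (bigD1 (Ordinal nd)) //= addrCA lerDl addr_ge0 //; first by rewrite addr_ge0.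
    by apply: sumr_ge0.
  rewrite {1}/t sE //; apply: le_trans (ler_norm_sum _ _ _) _.
  apply: le_trans (_ : (\sum_(1 <= j < d.+1) `|c j|) * K ^+ n <= _).
    rewrite mulr_suml big_nat_cond [X in _ <= X]big_nat_cond.
    apply: ler_sum => j; rewrite andbT => /andP[j1 jd].
    rewrite normrM ler_wpM2l //.
    have jn : (n - j < n)%N by lia.
    by apply: le_trans (IH _ jn) _; apply: ler_weXn2l.
  rewrite exprS ler_wpM2r ?exprn_ge0 ?(le_trans ler01) //.
  by rewrite /K addrAC lerDr addr_ge0.
have [x Kx] : exists x : R, K = x%:C%C.
  by apply/complex_realP; rewrite ger0_real // (le_trans ler01).
exists (Num.bound x) => n.
have KC : K <= (Num.bound x)%:R.
  have -> : ((Num.bound x)%:R : complex R) = ((Num.bound x)%:R : R)%:C%C.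
    by rewrite rmorph_nat.
  rewrite Kx lecR; apply: ltW; apply: archi_boundP.
  by rewrite -(lecR 0 x) -Kx (le_trans ler01).
rewrite -(ler_int (complex R)).
apply: le_trans (real_ler_norm _) _; first by rewrite realz.
apply: le_trans (tK n) _.
rewrite -pmulrn natrX lerXn2r ?nnegrE ?(le_trans ler01) //.
by rewrite (le_trans K_ge1).
Qed.

(** If, from N on, every window of length D contained a value above
    (C + 2)^(2 D), the product over t consecutive windows would be at least
    (C + 2)^(2 D t); the hypothesis allows only about C^(D t). *)
Lemma bounded_windows (b : nat -> nat) (C D : nat) :
  (0 < D)%N -> (forall n, 0 < b n)%N ->
  (forall n, \prod_(k < n) b k <= C ^ n.+1)%N ->
  exists B : nat, forall N, exists2 n, (N <= n)%N &
    forall k, (k < D)%N -> (b (n + k) <= B)%N.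
Proof.
move=> D_gt0 b_gt0 bC; pose B := (C.+2 ^ (2 * D))%N; exists B => N.
apply: contrapT => noN.
have large n : (N <= n)%N -> exists2 k, (k < D)%N & (B < b (n + k))%N.
  move=> Nn; apply: contrapT => nok; apply: noN; exists n => // k kD.
  by rewrite leqNgt; apply/negP => Bb; apply: nok; exists k.
have lower t : (B ^ t <= \prod_(k < N + D * t) b k)%N.
  elim: t => [|t IH]; first by rewrite expn0 prodn_gt0.
  rewrite mulnS [(D + _)%N]addnC addnA big_split_ord /= expnSr leq_mul //.
  have [k kD Bk] := large _ (leq_addr (D * t) N).
  rewrite (bigD1 (Ordinal kD)) //= (leq_trans (ltnW Bk)) // leq_pmulr //.
  by rewrite prodn_gt0.
(* N + 2 windows suffice to absorb the N initial terms and the extra factor. *)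
have := leq_trans (lower N.+2) (bC _).
rewrite leqNgt => /negP; apply; rewrite /B -expnM.
apply: (@leq_ltn_trans (C.+2 ^ (N + D * N.+2).+1)).
  by rewrite leq_exp2r // ltnW.
by rewrite ltn_exp2l //; nia.
Qed.

(** * Finite memory and pigeonhole *)

(** Among infinitely many windows over the finite alphabet S two coincide, and
    from equal windows the sequence continues identically. *)
Lemma recurrent_window_periodic (T : eqType) (x : nat -> T) (D N0 : nat) (S : seq T) :
  (forall N, exists2 n, (N <= n)%N & forall k, (k < D)%N -> x (n + k)%N \in S) ->
  (forall n n', (N0 <= n)%N -> (N0 <= n')%N ->
     (forall k, (k < D)%N -> x (n + k)%N = x (n' + k)%N) ->
     x (n + D)%N = x (n' + D)%N) ->
  eventually_periodic x.
Proof.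
move=> windows determined.
have /choice[f fP] : forall N, exists n,
    (N <= n)%N /\ forall k, (k < D)%N -> x (n + k)%N \in S.
  by move=> N; have [n] := windows N; exists n.
pose g j := iter j.+1 (fun n => f n.+1) N0.
have gS j : (g j < g j.+1)%N by have [] := fP (g j).+1.
have g_incr i j : (i < j)%N -> (g i < g j)%N.
  by move/(homo_ltn ltn_trans gS); apply.
have g_ge j : (N0 <= g j)%N.
  have g0 : (N0 <= g 0%N)%N by apply: leq_trans (proj1 (fP N0.+1)).
  by case: j => // j; apply: leq_trans g0 (ltnW (g_incr _ _ _)).
have gP j k : (k < D)%N -> x (g j + k)%N \in S by apply: (proj2 (fP _)).
(* [index] encodes the letters of S; the value [size S], which codes any other
   letter, is never taken at the windows starting at some g j. *)
pose w n : {ffun 'I_D -> 'I_(size S).+1} :=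
  [ffun k : 'I_D => inord (index (x (n + k)%N) S)].
pose U : finType := {ffun 'I_D -> 'I_(size S).+1}.
have [i [j [ij wij]]] : exists i j, (i < j)%N /\ w (g i) = w (g j).
  pose h (i : 'I_#|U|.+1) : U := w (g i).
  have /injectivePn[i [j ij hij]] : ~~ injectiveb h.
    by apply/negP => /injectiveP/leq_card; rewrite card_ord ltnn.
  have : (i : nat) != j by [].
  by rewrite neq_ltn => /orP[ij'|ji']; [exists i, j | exists j, i].
have start k : (k < D)%N -> x (g i + k)%N = x (g j + k)%N.
  move=> kD; have := congr1 (fun u : U => u (Ordinal kD) : nat) wij.
  rewrite !ffunE /= !inordK ?ltnS ?index_size //= => eq_index.
  by rewrite -(nth_index (x 0%N) (gP i k kD)) eq_index nth_index ?gP.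
have agree k : x (g i + k)%N = x (g j + k)%N.
  elim/ltn_ind: k => k IH; case: (ltnP k D) => [/start //|Dk].
  have := determined (g i + (k - D))%N (g j + (k - D))%N.
  rewrite -!addnA subnK //; apply.
  - exact: leq_trans (g_ge i) (leq_addr _ _).
  - exact: leq_trans (g_ge j) (leq_addr _ _).
  - by move=> l lD; rewrite -!addnA; apply: IH; lia.
have gij := g_incr _ _ ij.
exists (g i), (g j - g i)%N; split; first by lia.
move=> n gn; have := agree (n - g i)%N.
have -> : (g i + (n - g i) = n)%N by lia.
by have -> : (g j + (n - g i) = n + (g j - g i))%N by lia.
Qed.

(** The products W n k = X_n ... X_{n+k-1} = V_n^-1 V_{n+k} satisfy the recurrence
    carried by p, without reference to V_n; hence W n (D+1) is determined by the
    W n k with k <= D, and X_{n+D} is the quotient of W n (D+1) by W n D. *)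
Lemma transition_determined (F : fieldType) (L : unitAlgType F) (V X : nat -> L)
    (p : {poly F}) (D N0 : nat) :
  (forall n, V n \is a GRing.unit) ->
  (forall n, V n.+1 = V n * X n) ->
  p \is monic -> size p = D.+2 ->
  (forall n, (N0 <= n)%N -> \sum_(k < size p) p`_k *: V (n + k)%N = 0) ->
  forall n n', (N0 <= n)%N -> (N0 <= n')%N ->
    (forall k, (k < D)%N -> X (n + k)%N = X (n' + k)%N) ->
    X (n + D)%N = X (n' + D)%N.
Proof.
move=> V_unit VX p_monic p_size pV n n' Nn Nn' Xeq.
pose W n k := (V n)^-1 * V (n + k)%N.
have WS l k : W l k.+1 = W l k * X (l + k)%N by rewrite /W addnS VX mulrA.
have W_unit l k : W l k \is a GRing.unit by rewrite unitrMl ?unitrV V_unit.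
have Weq k : (k <= D)%N -> W n k = W n' k.
  elim: k => [|k IH] kD; first by rewrite /W !addn0 !mulVr.
  by rewrite !WS IH ?Xeq // ltnW.
have Wlast l : (N0 <= l)%N -> W l D.+1 = - \sum_(k < D.+1) p`_k *: W l k.
  move=> /pV/(congr1 (fun v => (V l)^-1 * v)).
  rewrite mulr0 p_size big_ord_recr /=.
  have -> : p`_D.+1 = 1 by rewrite -(monicP p_monic) lead_coefE p_size.
  rewrite scale1r mulrDr mulr_sumr addrC => /eqP.
  rewrite addr_eq0 -/(W l D.+1) => /eqP ->; congr (- _).
  by apply: eq_bigr => k _; rewrite scalerAr.
apply: (mulrI (W_unit n D)).
rewrite -WS [in RHS]Weq // -WS !Wlast //; congr (- _).
by apply: eq_bigr => k _; rewrite Weq // -ltnS.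
Qed.

Lemma bounded_matrix_finite (m n B : nat) : exists S : seq 'M[int]_(m, n),
  forall M : 'M[int]_(m, n), (forall i j, 0 <= M i j <= B%:Z) -> M \in S.
Proof.
exists (codom (map_mx (fun k : 'I_B.+1 => Posz k) : 'M_(m, n) -> 'M_(m, n))) => M MB.
apply/codomP; exists (\matrix_(i, j) inord `|M i j|%N).
apply/matrixP => i j; rewrite !mxE.
have := MB i j; move=> /andP[M0 M1]; rewrite inordK; last by lia.
by rewrite gez0_abs.
Qed.

(** * The matrices of the algorithm *)

(** The columns are indexed so that right multiplication by this matrix sends
    (A_n, ..., A_{n-m}) to (A_{n+1}, ..., A_{n+1-m}): the first column holds the
    coefficients of the recursion, the others shift. *)
Definition quotient_matrix (m : nat) (a : nat -> int) : 'M[int]_m.+1 :=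
  \matrix_(i, j) if j == ord0 then (if (i < m)%N then a i.+1 else 1)
                 else (i.+1 == j)%:R.

(** The last row is (1, 0, ..., 0), and deleting it together with the first column
    leaves the identity, so the determinant is a sign. *)
Lemma unit_quotient_matrix (m : nat) (a : nat -> int) :
  quotient_matrix m a \in unitmx.
Proof.
rewrite unitmxE (expand_det_row _ ord_max) (bigD1 ord0) //= big1 => [|j j0].
  rewrite addr0 mxE eqxx ltnn mul1r /cofactor.
  suff -> : row' ord_max (col' ord0 (quotient_matrix m a)) = 1%:M.
    by rewrite det1 mulr1 unitrX // unitrN1.
  by apply/matrixP => i j; rewrite !mxE /= /bump /= leqNgt ltn_ord.
rewrite mxE (negbTE j0) /= gtn_eqF ?mul0r //; exact: ltn_ord.
Qed.

Definition convergent_matrix (m : nat) (A : nat -> int -> int) (n : nat) :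
    'M[int]_m.+1 :=
  \matrix_(i, j) A i.+1 (n%:Z - (j : nat)%:Z).

(** The initial conditions say V_0 = X_{-1}, as if V_{-1} were the identity. *)
Lemma convergent_matrix0 (m : nat) (a : nat -> nat -> int) (A : nat -> int -> int) :
  jp_convergents m a A -> convergent_matrix m A 0 = quotient_matrix m (a 0%N).
Proof.
move=> [A0 Adiag Aoff Aden0 Adenneg _]; apply/matrixP => i j; rewrite !mxE sub0r.
have im : (i <= m)%N by rewrite -ltnS.
have jm : (j <= m)%N by rewrite -ltnS.
case: eqP => [->|/eqP j0].
  rewrite oppr0; case: ltnP => mi; first by apply: A0.
  by have -> : i = m :> nat by lia.
have {}j0 : (0 < j)%N by rewrite lt0n.
case: (ltnP i m) => mi.
  case: eqP => [<-|/eqP ij]; first by rewrite Adiag.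
  by rewrite Aoff ?jm ?j0 // eq_sym.
have -> : i = m :> nat by lia.
by rewrite Adenneg ?j0 // gtn_eqF.
Qed.

Lemma convergent_matrixS (m : nat) (a : nat -> nat -> int) (A : nat -> int -> int)
    (n : nat) :
  jp_convergents m a A ->
  convergent_matrix m A n.+1 = convergent_matrix m A n *m quotient_matrix m (a n.+1).
Proof.
move=> [_ _ _ _ _ Arec]; apply/matrixP => i j; rewrite !mxE.
have im : (i <= m)%N by rewrite -ltnS.
case: (eqVneq j ord0) => [->|j0].
  rewrite subr0 Arec // big_ord_recr /= !mxE eqxx ltnn mulr1.
  congr (_ + _); last by congr (A _ _); rewrite /=; lia.
  rewrite big_add1 big_mkord; apply: eq_bigr => k _.
  rewrite !mxE /= ltn_ord mulrC; congr (A _ _ * _). rewrite /=; lia.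
have j1 : (0 < j)%N by rewrite lt0n.
have jm : (j.-1 < m.+1)%N by rewrite (leq_ltn_trans (leq_pred j)).
rewrite (bigD1 (Ordinal jm)) //= !mxE (negbTE j0) /= prednK // eqxx mulr1.
rewrite big1 ?addr0 => [|k kj]; first by congr (A _ _); lia.
rewrite !mxE (negbTE j0) /=; case: eqP => [kj'|]; last by rewrite mulr0.
by move: kj; rewrite -val_eqE /= -kj' eqxx.
Qed.

Lemma unit_convergent_matrix (m : nat) (a : nat -> nat -> int)
    (A : nat -> int -> int) (n : nat) :
  jp_convergents m a A -> convergent_matrix m A n \in unitmx.
Proof.
move=> hA; elim: n => [|n IH].
  by rewrite (convergent_matrix0 hA) unit_quotient_matrix.
by rewrite (convergent_matrixS n hA) unitmx_mul IH unit_quotient_matrix.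
Qed.

(** * Size of the partial quotients and of the denominators *)

(** After one step the first coordinate is 1 / x and the others are y / x, with
    0 < x < 1 and 0 <= y < 1. *)
Lemma jp_quotient_bounds (R : realType) (m : nat) (alpha : nat -> R) (n i : nat) :
  (1 <= m)%N -> jp_nonterminating m alpha -> (1 <= i <= m)%N ->
  [/\ 1 <= jp_quotient m alpha n.+1 1, 0 <= jp_quotient m alpha n.+1 i &
      jp_quotient m alpha n.+1 i <= jp_quotient m alpha n.+1 1].
Proof.
move=> hm nonterm /andP[i1 im].
pose frac j := jp_complete m alpha n j - (jp_quotient m alpha n j)%:~R.
have frac_ge0 j : 0 <= frac j by rewrite subr_ge0 floor_le.
have frac_lt1 j : frac j < 1.
  by rewrite ltrBlDl -[X in _ + X]/(1%:~R) -intrD floorD1_gt.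
have fracm : 0 < frac m.
  by rewrite lt_def frac_ge0 andbT subr_eq0; apply/eqP/nonterm.
have x1 : jp_complete m alpha n.+1 1 = 1 / frac m by [].
have xi : i != 1%N -> jp_complete m alpha n.+1 i = frac i.-1 / frac m.
  by move=> /negbTE /= ->.
have a1 : 1 <= jp_quotient m alpha n.+1 1.
  by rewrite /jp_quotient floor_ge_int x1 lter_pdivlMr // mul1r ltW.
case: (eqVneq i 1%N) => [->|i_neq1]; first by split=> //; apply: le_trans a1.
split=> //; rewrite /jp_quotient ?xi //.
  by rewrite floor_ge_int divr_ge0.
by apply: le_floor; rewrite x1 ler_pM2r ?invr_gt0 // ltW.
Qed.

Lemma jp_denominator_ge0 (m : nat) (a : nat -> nat -> int) (A : nat -> int -> int) :
  jp_convergents m a A ->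
  (forall n i, (1 <= i <= m)%N -> 0 <= a n.+1 i) ->
  forall n j : nat, (j <= m)%N -> 0 <= A m.+1 (n%:Z - j%:Z).
Proof.
move=> [_ _ _ A0 Aneg Arec] a_ge0.
have nonpos j : (j <= m)%N -> 0 <= A m.+1 (- j%:Z).
  by case: j => [|j] jm; rewrite ?oppr0 ?A0 ?Aneg.
suff nonneg n : 0 <= A m.+1 n%:Z.
  move=> n j jm; case: (leqP j n) => jn; first by rewrite subzn.
  have -> : n%:Z - j%:Z = - (j - n)%N%:Z by lia.
  by apply: nonpos; lia.
elim/ltn_ind: n => -[_|n IH]; first by rewrite A0.
have earlier j : (1 <= j <= m.+1)%N -> 0 <= A m.+1 (n.+1%:Z - j%:Z).
  move=> j1; case: (leqP j n.+1) => jn; first by rewrite subzn // IH; lia.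
  have -> : n.+1%:Z - j%:Z = - (j - n.+1)%N%:Z by lia.
  by apply: nonpos; lia.
rewrite Arec ?leqnn //; apply: addr_ge0.
  rewrite big_nat; apply: sumr_ge0 => j j1.
  by rewrite mulr_ge0 ?a_ge0 ?earlier //; lia.
have -> : n.+1%:Z - m%:Z - 1 = n.+1%:Z - m.+1%:Z by lia.
by apply: earlier; rewrite leqnn.
Qed.

(** Dropping all terms of the recursion but the first leaves
    A_{n+1} >= a_{n+1}^(1) A_n. *)
Lemma prod_le_jp_denominator (m : nat) (a : nat -> nat -> int)
    (A : nat -> int -> int) :
  (1 <= m)%N -> jp_convergents m a A ->
  (forall n i, (1 <= i <= m)%N -> 0 <= a n.+1 i) ->
  forall n, (\prod_(k < n) `|a k.+1 1%N|)%N%:Z <= A m.+1 n%:Z.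
Proof.
move=> hm hA a_ge0; elim=> [|n IH]; first by rewrite big_ord0 (jp_den0 hA).
have A_ge0 := jp_denominator_ge0 hA a_ge0.
rewrite big_ord_recr /= PoszM gez0_abs ?a_ge0 ?hm // mulrC.
rewrite (jp_rec hA) ?leqnn // big_ltn //.
have shift j : n.+1%:Z - j.+1%:Z = n%:Z - j%:Z by lia.
rewrite -[X in _ <= X]addrA; apply: ler_wpDr; last first.
  by rewrite shift subr0 ler_wpM2l // a_ge0 ?hm.
apply: addr_ge0; last by have := A_ge0 n m (leqnn m); congr (0 <= A _ _); lia.
rewrite big_nat; apply: sumr_ge0 => -[//|j] j1.
by rewrite shift mulr_ge0 ?a_ge0 ?A_ge0 //; lia.
Qed.

Unset Implicit Arguments.
Set Strict Implicit.

Theorem theorem3p7 (R : realType) (m : nat) (hm : (1 <= m)%N)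
  (alpha : nat -> R)
  (halpha : forall i : nat, (1 <= i <= m)%N -> irrational (alpha i))
  (hnonterm : jp_nonterminating m alpha)
  (A : nat -> int -> int)
  (hA : jp_convergents m (jp_quotient m alpha) A)
  (hrec : forall i : nat, (1 <= i <= m.+1)%N ->
    linear_recurrence (fun n : nat => (A i n%:Z)%:~R : complex R)) :
  forall i : nat, (1 <= i <= m)%N ->
    eventually_periodic (fun n : nat => jp_quotient m alpha n i).
Proof.
pose a := jp_quotient m alpha.
have a_bounds n i : (1 <= i <= m)%N ->
    [/\ 1 <= a n.+1 1%N, 0 <= a n.+1 i & a n.+1 i <= a n.+1 1%N].
  exact: jp_quotient_bounds.
have a1_ge1 n : 1 <= a n.+1 1%N by have [] := a_bounds n 1%N hm.
have a_ge0 n i : (1 <= i <= m)%N -> 0 <= a n.+1 i by move/(a_bounds n) => [].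
have [p p_monic pA] : exists2 p : {poly complex R}, p \is monic &
    forall i, (i < m.+1)%N -> annihilates p (fun n => (A i.+1 n%:Z)%:~R).
  by apply: common_annihilator => i im; apply: hrec.
(* The factor 'X^2 makes the degree of q equal to D.+1 with D > 0, whatever p. *)
pose D := size p; pose q := p * 'X ^+ 2.
have p_gt0 : (0 < size p)%N by rewrite size_poly_gt0 monic_neq0.
have q_size : size q = D.+2 by rewrite size_Mmonic ?monic_neq0 ?monicXn // size_polyXn addn3.
have q_monic : q \is monic by rewrite monicMl ?monicXn.
pose x n := quotient_matrix m (a n.+1).
pose toF := map_mx (intr : int -> complex R) : 'M[int]_m.+1 -> 'M_m.+1.
have toF_inj : injective toF.
  move=> M N /matrixP MN; apply/matrixP => i j; apply: (@intr_inj (complex R)).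
  by have := MN i j; rewrite !mxE.
have determined n n' : (m <= n)%N -> (m <= n')%N ->
    (forall k, (k < D)%N -> x (n + k)%N = x (n' + k)%N) ->
    x (n + D)%N = x (n' + D)%N.
  move=> mn mn' xeq; apply: toF_inj.
  have := @transition_determined _ 'M[complex R]_m.+1
    (fun l => toF (convergent_matrix m A l)) (fun l => toF (x l)) q D m.
  apply=> // [l|l|l ml|k kD]; last by rewrite /toF xeq.
  - rewrite /toF; apply: (_ : map_mx _ _ \in unitmx); rewrite unitmxE det_map_mx.
    by rewrite rmorph_unit // -unitmxE (unit_convergent_matrix _ hA).
  - by rewrite /toF (convergent_matrixS _ hA) map_mxM.
  (* Column j of V_l reads the sequences at l - j, an index that must be
     nonnegative for the recurrence to apply: hence the bound m <= l. *)
  apply/matrixP => i j; rewrite summxE [RHS]mxE.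
  have jm : (j <= m)%N by rewrite -ltnS.
  have := annihilatesM 'X^2 (pA i (ltn_ord i)) (l - j)%N.
  rewrite mulrC -/q /shift_apply => pA0; rewrite -[RHS]pA0; apply: eq_bigr => k _.
  by rewrite !mxE; congr (_ * (A _ _)%:~R); lia.
have [C AC] := linear_recurrence_growth (hrec m.+1 (leqnn _)).
have [//|n|n|B windows] := @bounded_windows (fun n => `|a n.+1 1%N|%N) C D.
- by have := a1_ge1 n; lia.
- by rewrite -lez_nat (le_trans (prod_le_jp_denominator hm hA a_ge0 n)).
have [S SP] := bounded_matrix_finite m.+1 m.+1 B.
have [|N [t [t_gt0 xt]]] := @recurrent_window_periodic _ x D m S _ determined.
  move=> N; have [n Nn small] := windows N; exists n => // k kD.
  apply: SP => i j; rewrite mxE; have := small k kD; have := a1_ge1 (n + k)%N.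
  case: ifP => _; last by case: (_ == _); lia.
  case: ifP => im; last by lia.
  by have [//|? ? ?] := a_bounds (n + k)%N i.+1; lia.
move=> i /andP[i1 im]; exists N.+1, t; split=> // -[//|n] Nn.
have im' : (i.-1 < m.+1)%N by lia.
have := congr1 (fun M : 'M_m.+1 => M (Ordinal im') ord0) (xt n Nn).
have im'' : (i.-1 < m)%N by lia.
by rewrite !mxE /= im'' prednK.
Qed.
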